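(* Let $f:N\to E^4$ be an immersion of an oriented surface $N$ into $E^4$. Then: (1) $f$ is slant with respect to some complex structure $J\in\mathcal J^+$ (respectively, $J\in\mathcal J^-$) if and only if $\nu_+(N)$ (respectively, $\nu_-(N)$) is contained in a circle on $S^2_+$ (respectively, on $S^2_-$). (2) $f$ is $\alpha$-slant with respect to a complex structure $J\in\mathcal J^+$ (respectively, $J\in\mathcal J^-$) if and only if $\nu_+(N)$ (respectively, $\nu_-(N)$) is contained in the circle $S^+_{J,\alpha}$ on $S^2_+$ (respectively, $S^-_{J,\alpha}$ on $S^2_-$).
   Context: $E^4$ is oriented Euclidean $4$-space. $\mathcal J$ is the set of linear $J:E^4\to E^4$ with $J^2=-I$ and $\langle JX,JY\rangle=\langle X,Y\rangle$. A $J$-basis is an orthonormal basis $e_1,\dots,e_4$ with $Je_1=e_2$, $Je_3=e_4$; $\mathcal J^+$ (resp. $\mathcal J^-$) is the set of $J\in\mathcal J$ whose $J$-bases are positive (resp. negative). $G(2,4)$ is the set of oriented $2$-planes in $E^4$, identified with unit decomposable $2$-vectors in $\wedge^2E^4$, $V\mapsto e_1\wedge e_2$ for a positive orthonormal basis of $V$; the inner product on $\wedge^2E^4$ is $\langle X_1\wedge X_2,Y_1\wedge Y_2\rangle=\det(\langle X_i,Y_j\rangle)$. $\wedge^2E^4=\wedge^2_+E^4\oplus\wedge^2_-E^4$ is the decomposition into $\pm1$-eigenspaces of the Hodge star operator, $\pi_\pm$ the orthogonal projections, and $S^2_\pm$ the $2$-sphere of radius $1/\sqrt2$ centered at the origin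 in $\wedge^2_\pm E^4$; $\pi_\pm$ maps $G(2,4)$ to $S^2_\pm$. The Gauss map is $\nu(p)=T_pN\in G(2,4)$, and $\nu_\pm=\pi_\pm\circ\nu:N\to S^2_\pm$. For $V\in G(2,4)$ with positive orthonormal basis $e_1,e_2$ put $\alpha_J(V)=\cos^{-1}\langle Je_1,e_2\rangle\in[0,\pi]$. $f$ is $\alpha$-slant with respect to $J$ if $\alpha_J(T_pN)=\alpha$ for all $p\in N$, and slant with respect to $J$ if it is $\alpha$-slant for some constant $\alpha\in[0,\pi]$. $\zeta_J\in\wedge^2E^4$ is defined by $\langle\zeta_J,X\wedge Y\rangle=-\langle X,JY\rangle$; for $J\in\mathcal J^\pm$ it lies in $\wedge^2_\pm E^4$. $S^\pm_{J,\alpha}$ is the circle (a single point if $\alpha=0,\pi$) on $S^2_\pm$ consisting of the $2$-vectors making constant angle $\alpha$ with $\zeta_J$. *)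

(* Defs.v *)
From HB Require Import structures.
From mathcomp Require Import all_boot all_order all_algebra.
From mathcomp Require Import all_classical all_reals all_analysis.
From mathcomp Require Import ring lra.

Set Implicit Arguments.
Unset Strict Implicit.
Unset Printing Implicit Defensive.

Import Order.TTheory GRing.Theory Num.Theory.
Import numFieldNormedType.Exports.

Local Open Scope classical_set_scope.
Local Open Scope ring_scope.

Section Algebra.
Context {R : realType}.

(* E^4 is 'rV[R]_4, oriented by the standard basis.  The norm that the library
   puts on 'rV[R]_4 is the sup norm, so the Euclidean product is separate. *)
Definition dot (X Y : 'rV[R]_4) : R := (X *m Y^T) 0 0.

(* /\^2 E^4 is modelled by the skew-symmetric 4 x 4 matrices; the entry (i, j)
   with i < j is the coordinate on e_i /\ e_j. *)
Definition skew_mx : set 'M[R]_4 := [set A | A^T = - A].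

Definition wedge (X Y : 'rV[R]_4) : 'M[R]_4 := X^T *m Y - Y^T *m X.

Definition ip (A B : 'M[R]_4) : R := 2^-1 * \tr (A *m B^T).

Definition norm2 (A : 'M[R]_4) : R := Num.sqrt (ip A A).

(* Levi-Civita symbol *)
Definition eps (i j k l : 'I_4) : int :=
  let d (a b : 'I_4) := (b : nat)%:Z - (a : nat)%:Z in
  sgz (d i j * d i k * d i l * d j k * d j l * d k l).

Definition star (A : 'M[R]_4) : 'M[R]_4 :=
  \matrix_(i, j) (2^-1 * \sum_k \sum_l (eps i j k l)%:~R * A k l).

(* Throughout, the sign s : bool stands for (-1) ^+ s: false is +, true is -. *)
Definition wedge_pm (s : bool) : set 'M[R]_4 :=
  [set A | skew_mx A /\ star A = (-1) ^+ s *: A].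

(* orthogonal projection onto wedge_pm s, see proj_in and proj_orth *)
Definition proj_pm (s : bool) (A : 'M[R]_4) : 'M[R]_4 :=
  2^-1 *: (A + (-1) ^+ s *: star A).

Definition S2 (s : bool) : set 'M[R]_4 :=
  [set A | wedge_pm s A /\ norm2 A = (Num.sqrt 2)^-1].

Definition circle_on_S2 (s : bool) (C : set 'M[R]_4) : Prop :=
  C `<=` S2 s /\
  exists c n r, [/\ wedge_pm s c, wedge_pm s n, n != 0, 0 < r &
    C = [set A | [/\ wedge_pm s A, ip (A - c) n = 0 & norm2 (A - c) = r]]].

Definition angle (A B : 'M[R]_4) : R := acos (ip A B / (norm2 A * norm2 B)).

Definition cstruct : set {linear 'rV[R]_4 -> 'rV[R]_4} :=
  [set J | (forall X, J (J X) = - X) /\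
           (forall X Y, dot (J X) (J Y) = dot X Y)].

(* A basis e_1, ..., e_4 is given by the matrix B with rows e_i. *)
Definition J_basis (J : {linear 'rV[R]_4 -> 'rV[R]_4}) (B : 'M[R]_4) : Prop :=
  [/\ B *m B^T = 1%:M,
      J (row (inord 0) B) = row (inord 1) B &
      J (row (inord 2) B) = row (inord 3) B].

Definition cstruct_pm (s : bool) : set {linear 'rV[R]_4 -> 'rV[R]_4} :=
  [set J | cstruct J /\ forall B, J_basis J B -> 0 < (-1) ^+ s * \det B].

(* characterized by zeta_wedge *)
Definition zeta (J : {linear 'rV[R]_4 -> 'rV[R]_4}) : 'M[R]_4 :=
  \matrix_(i, j) - dot (delta_mx 0 i) (J (delta_mx 0 j)).

Definition S_circle (s : bool) (J : {linear 'rV[R]_4 -> 'rV[R]_4}) (a : R) :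
    set 'M[R]_4 :=
  [set A | S2 s A /\ angle A (zeta J) = a].

(* An orthonormal pair e_1, e_2 is given by the 2 x 4 matrix E with rows e_i. *)
Definition orthonormal_pair (E : 'M[R]_(2, 4)) : Prop := E *m E^T = 1%:M.

Definition wedge_rows (E : 'M[R]_(2, 4)) : 'M[R]_4 :=
  wedge (row 0 E) (row 1 E).

(* The positive orthonormal bases of an oriented plane, the plane being
   identified with the unit decomposable 2-vector V. *)
Definition pos_onb (V : 'M[R]_4) : set 'M[R]_(2, 4) :=
  [set E | orthonormal_pair E /\ wedge_rows E = V].

Definition G24 : set 'M[R]_4 := [set V | exists E, pos_onb V E].

(* independent of the chosen basis, see alphaE *)
Definition alpha (J : {linear 'rV[R]_4 -> 'rV[R]_4}) (V : 'M[R]_4) : R :=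
  let E := get (pos_onb V) in acos (dot (J (row 0 E)) (row 1 E)).

End Algebra.

Section Facts.
Context {R : realType}.
Implicit Types (A B V : 'M[R]_4) (X Y Z W : 'rV[R]_4).
Implicit Types (J : {linear 'rV[R]_4 -> 'rV[R]_4}) (E F : 'M[R]_(2, 4)).

Local Notation o0 := (@Ordinal 4 0 isT).
Local Notation o1 := (@Ordinal 4 1 isT).
Local Notation o2 := (@Ordinal 4 2 isT).
Local Notation o3 := (@Ordinal 4 3 isT).

Lemma sum4 (U : nmodType) (F : 'I_4 -> U) :
  \sum_i F i = F o0 + F o1 + F o2 + F o3.
Proof.
rewrite !big_ord_recl big_ord0 addr0 !addrA.
by congr (F _ + F _ + F _ + F _); apply/val_inj.
Qed.

Lemma forall4 (P : 'I_4 -> Prop) :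
  P o0 -> P o1 -> P o2 -> P o3 -> forall i, P i.
Proof.
move=> P0 P1 P2 P3 [[|[|[|[|//]]]] lti].
- by rewrite (_ : Ordinal lti = o0) //; apply/val_inj.
- by rewrite (_ : Ordinal lti = o1) //; apply/val_inj.
- by rewrite (_ : Ordinal lti = o2) //; apply/val_inj.
- by rewrite (_ : Ordinal lti = o3) //; apply/val_inj.
Qed.

Lemma dotE X Y :
  dot X Y = X 0 o0 * Y 0 o0 + X 0 o1 * Y 0 o1 + X 0 o2 * Y 0 o2 + X 0 o3 * Y 0 o3.
Proof. by rewrite /dot mxE sum4 !mxE. Qed.

Lemma ipE A B : ip A B = 2^-1 * \sum_i \sum_j A i j * B i j.
Proof.
rewrite /ip /mxtrace; congr (_ * _); apply: eq_bigr => i _.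
by rewrite mxE; apply: eq_bigr => j _; rewrite mxE.
Qed.

Lemma wedgeE X Y i j : wedge X Y i j = X 0 i * Y 0 j - Y 0 i * X 0 j.
Proof. by rewrite !mxE !big_ord1 !mxE. Qed.

Lemma ip_wedge X Y Z W :
  ip (wedge X Y) (wedge Z W) = dot X Z * dot Y W - dot X W * dot Y Z.
Proof. rewrite ipE !dotE !sum4 !wedgeE; by field. Qed.

Local Ltac eps_eval := repeat match goal with |- context [eps ?a ?b ?c ?d] =>
  let v := eval vm_compute in (eps a b c d) in
  change (eps a b c d) with v end.

Lemma starE A : star A = \matrix_(i < 4, j < 4)
  (nth 0 (nth [::] [::
   [:: 0; A o2 o3 - A o3 o2; A o3 o1 - A o1 o3; A o1 o2 - A o2 o1];
   [:: A o3 o2 - A o2 o3; 0; A o0 o3 - A o3 o0; A o2 o0 - A o0 o2];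
   [:: A o1 o3 - A o3 o1; A o3 o0 - A o0 o3; 0; A o0 o1 - A o1 o0];
   [:: A o2 o1 - A o1 o2; A o0 o2 - A o2 o0; A o1 o0 - A o0 o1; 0]] i) j / 2).
Proof.
apply/matrixP; elim/forall4 => j; elim/forall4: j.
all: rewrite !mxE !sum4 /=; eps_eval; rewrite /= ?mulr0z; 
  rewrite -?[(Negz 0)%:~R]/(-1) -?[(Posz 1)%:~R]/(1); ring.
Qed.


Lemma starD A B : star (A + B) = star A + star B.
Proof.
apply/matrixP => i j.
have e : \sum_k \sum_l (eps i j k l)%:~R * (A + B) k l =
    \sum_k \sum_l (eps i j k l)%:~R * A k l +
    \sum_k \sum_l (eps i j k l)%:~R * B k l :> R.
  rewrite -big_split; apply: eq_bigr => k _ /=.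
  rewrite -big_split; apply: eq_bigr => l _ /=.
  by rewrite mxE mulrDr.
by rewrite !mxE e mulrDr.
Qed.

Lemma starZ (a : R) A : star (a *: A) = a *: star A.
Proof.
apply/matrixP => i j.
have e : \sum_k \sum_l (eps i j k l)%:~R * (a *: A) k l =
    a * \sum_k \sum_l (eps i j k l)%:~R * A k l :> R.
  rewrite mulr_sumr; apply: eq_bigr => k _ /=.
  rewrite mulr_sumr; apply: eq_bigr => l _ /=.
  by rewrite mxE mulrCA.
by rewrite !mxE e mulrCA.
Qed.

Lemma skewP A : skew_mx A -> forall i j, A i j = - A j i.
Proof. by move=> /matrixP sA i j; have := sA j i; rewrite !mxE. Qed.

Lemma skew0 A : skew_mx A -> forall i, A i i = 0.
Proof. by move=> /skewP sA i; have := sA i i; lra. Qed.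

Lemma star_skew A : skew_mx (star A).
Proof.
by apply/matrixP; elim/forall4 => j; elim/forall4: j;
  rewrite !starE !mxE /=; ring.
Qed.

Lemma star_star A : skew_mx A -> star (star A) = A.
Proof.
move=> sA; apply/matrixP; elim/forall4 => j; elim/forall4: j;
  rewrite (starE (star A)) mxE /= ?starE ?mxE /= ?(skew0 sA) ?(skewP sA o1 o0) ?(skewP sA o2 o0)
    ?(skewP sA o3 o0) ?(skewP sA o2 o1) ?(skewP sA o3 o1) ?(skewP sA o3 o2);
  by field.
Qed.

Lemma ip_star A B : ip (star A) B = ip A (star B).
Proof.
rewrite !ipE !sum4; apply: (congr1 ( *%R 2^-1)).
by rewrite !starE; rewrite !mxE /=; ring.
Qed.

Lemma proj_in s A : skew_mx A -> wedge_pm s (proj_pm s A).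
Proof.
move=> sA; split.
  rewrite /skew_mx /= /proj_pm linearZ linearD /= linearZ /= sA star_skew.
  by rewrite !scalerN -opprD scalerN.
rewrite /proj_pm starZ starD starZ star_star //.
by rewrite [RHS]scalerA (mulrC _ 2^-1) -[RHS]scalerA; congr (_ *: _);
  rewrite scalerDr scalerA -expr2 sqrr_sign scale1r addrC.
Qed.

Lemma proj_orth s A B : skew_mx A -> wedge_pm s B -> ip (A - proj_pm s A) B = 0.
Proof.
move=> sA [sB eB].
have ipD C D (E : 'M[R]_4) : ip (C + D) E = ip C E + ip D E.
  by rewrite /ip mulmxDl linearD mulrDr.
have ipZ a C D : ip (a *: C) D = a * ip C D.
  by rewrite /ip -scalemxAl linearZ /= mulrCA.
have ipZr a C D : ip D (a *: C) = a * ip D C.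
  by rewrite /ip linearZ /= -scalemxAr linearZ /= mulrCA.
rewrite -scaleN1r ipD !ipZ ipD ipZ ip_star eB ipZr (mulrA ((-1) ^+ s)) -expr2 sqrr_sign.
by field.
Qed.

Lemma zeta_wedge J X Y : cstruct J -> ip (zeta J) (wedge X Y) = - dot X (J Y).
Proof.
move=> [J2 Jo].
have J1 (U V : 'rV[R]_4) : dot (J U) V = - dot U (J V).
  rewrite -(Jo U) J2 /dot; rewrite (raddfN (@trmx R 1 4)) mulmxN !mxE opprK; done.
set M := lin1_mx J.
have JM (U : 'rV[R]_4) : J U = U *m M by rewrite mul_rV_lin1.
have zE i j : zeta J i j = - M j i.
  by rewrite !mxE JM -rowE /dot -rowE !mxE.
have sM : skew_mx M.
  apply/matrixP => i j; have := J1 (delta_mx 0 i) (delta_mx 0 j).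
  by rewrite !JM -!rowE /dot trmx_delta -colE -rowE !mxE => ->; rewrite opprK.
move: M JM zE sM => M JM zE sM.
rewrite ipE !sum4 !zE !wedgeE JM !dotE !mxE !sum4 ?(skew0 sM) ?(skewP sM o1 o0) ?(skewP sM o2 o0)
    ?(skewP sM o3 o0) ?(skewP sM o2 o1) ?(skewP sM o3 o1) ?(skewP sM o3 o2).
by field.
Qed.

Lemma alphaE J V E : cstruct J -> pos_onb V E ->
  alpha J V = acos (dot (J (row 0 E)) (row 1 E)).
Proof.
move=> cJ VE.
have dotC X Y : dot X Y = dot Y X by rewrite !dotE; ring.
have key F : pos_onb V F -> dot (J (row 0 F)) (row 1 F) = ip (zeta J) V.
  move=> [_ <-]; rewrite /wedge_rows zeta_wedge //.
  by case: cJ => J2 Jo; rewrite -Jo J2 !dotE !mxE; ring.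
by rewrite /alpha !key //; apply: (@getPex _ (pos_onb V)); exists E.
Qed.

Lemma det2 (P : 'M[R]_2) : \det P = P 0 0 * P 1 1 - P 0 1 * P 1 0.
Proof.
rewrite (expand_det_row _ ord0) !big_ord_recl big_ord0 /cofactor.
rewrite !det_mx11 !mxE /= /bump /=.
rewrite (_ : lift ord0 ord0 = 1); last exact/val_inj.
rewrite (_ : lift 1 0 = 0); last exact/val_inj.
by rewrite expr0 expr1; ring.
Qed.

Lemma wedge_rowsM (P : 'M[R]_2) F :
  wedge_rows (P *m F) = \det P *: wedge_rows F.
Proof.
have rowPF i : row i (P *m F) = P i 0 *: row 0 F + P i 1 *: row 1 F.
  apply/matrixP => k j; rewrite !mxE !big_ord_recl big_ord0 addr0.
  by rewrite (_ : lift ord0 ord0 = 1) //; apply/val_inj.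
apply/matrixP => i j; rewrite /wedge_rows !rowPF det2 !mxE !big_ord1 !mxE.
by ring.
Qed.

Lemma wedge_rows_eq (Q : 'M[R]_2) E F : orthonormal_pair E ->
  orthonormal_pair F -> 0 < \det Q -> E = Q *m F ->
  wedge_rows E = wedge_rows F.
Proof.
move=> oE oF Q0 EQ; rewrite EQ wedge_rowsM.
suff -> : \det Q = 1 by rewrite scale1r.
have : \det (E *m E^T) = 1 by rewrite oE det1.
rewrite EQ trmx_mul mulmxA -(mulmxA Q) oF mulmx1 det_mulmx det_tr -expr2.
by move/eqP; rewrite sqrf_eq1 => /orP[/eqP //|/eqP Q1]; move: Q0; rewrite Q1; lra.
Qed.

Lemma dot_ge0 (X : 'rV[R]_4) : 0 <= dot X X.
Proof. by rewrite dotE; nra. Qed.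

Lemma dot_eq0 (X : 'rV[R]_4) : dot X X = 0 -> X = 0.
Proof.
rewrite dotE => XX; apply/matrixP => i; rewrite ord1; elim/forall4;
  rewrite mxE; nra.
Qed.

Lemma gram_schmidt F : \rank F = 2%N ->
  exists2 E, orthonormal_pair E & exists2 P : 'M[R]_2, 0 < \det P & E = P *m F.
Proof.
move=> rF; have freeF : row_free F by rewrite /row_free rF.
have [G GF] : exists G, F *m F^T = G by eexists.
have GE i j : G i j = dot (row i F) (row j F).
  rewrite -GF.
  by rewrite /dot tr_row -[in RHS]row_mul mxE -?colE !mxE; apply: eq_bigr => k _; rewrite !mxE.
have pos (v : 'rV[R]_2) : v != 0 -> 0 < dot (v *m F) (v *m F).
  move=> v0; rewrite lt_def dot_ge0 andbT; apply: contra v0 => /eqP/dot_eq0.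
  by move/(congr1 (mulmx^~ (pinvmx F))); rewrite /= mulmxKp // mul0mx => ->.
have GC : G 1 0 = G 0 1 by rewrite !GE !dotE; ring.
have dotL (u v : 'rV[R]_2) : dot (u *m F) (v *m F) =
    u 0 0 * v 0 0 * G 0 0 + u 0 1 * v 0 0 * G 0 1 + u 0 0 * v 0 1 * G 0 1 +
    u 0 1 * v 0 1 * G 1 1.
  rewrite /dot trmx_mul mulmxA -(mulmxA u) GF mxE !big_ord_recl big_ord0.
  rewrite !mxE !big_ord_recl !big_ord0 /= (_ : lift ord0 ord0 = 1); last exact/val_inj.
  by rewrite GC -[ord0]/(0 : 'I_2); ring.
pose row2 (a b : R) : 'rV[R]_2 := \row_j (if j == 0 then a else b).
have pos2 a b : (a != 0) || (b != 0) ->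
    0 < a * a * G 0 0 + 2 * a * b * G 0 1 + b * b * G 1 1.
  move=> ab; have := pos (row2 a b); rewrite dotL !mxE /= => H.
  have := H _; set t := _ + _; rewrite (_ : t = a * a * G 0 0 + 2 * a * b * G 0 1 + b * b * G 1 1); last by rewrite /t; ring.
  apply; apply: contraL ab => /eqP/matrixP r0.
  by have := r0 0 0; have := r0 0 1; rewrite !mxE /= => -> ->; rewrite eqxx.
set g := G 0 0 in pos2 *; set k := G 0 1 in pos2 *; set h := G 1 1 in pos2 *.
have g0 : 0 < g by have := pos2 1 0; rewrite oner_eq0 => /(_ isT); lra.
have D0 : 0 < g * h - k * k.
  have := pos2 (- k) g; rewrite (gt_eqF g0) orbT => /(_ isT) H.
  rewrite -(pmulr_rgt0 _ g0); apply: lt_le_trans H _; lra.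
pose a := Num.sqrt g; pose b := Num.sqrt (g * h - k * k).
have a0 : 0 < a by rewrite sqrtr_gt0.
have b0 : 0 < b by rewrite sqrtr_gt0.
have aa : a ^+ 2 = g by rewrite sqr_sqrtr // ltW.
have bb : b ^+ 2 = g * h - k * k by rewrite sqr_sqrtr // ltW.
pose P : 'M[R]_2 := \matrix_(i, j) if i == 0
  then (if j == 0 then a^-1 else 0) else (if j == 0 then - k / (a * b) else a / b).
have PE : (P 0 0 = a^-1) * (P 0 1 = 0) * (P 1 0 = - k / (a * b)) * (P 1 1 = a / b).
  by rewrite !mxE.
exists (P *m F); last first.
  exists P => //; rewrite det2 !PE; rewrite mul0r subr0 mulrA mulVf ?gt_eqF //.
  by rewrite mul1r invr_gt0.
rewrite /orthonormal_pair trmx_mul mulmxA -(mulmxA P) GF.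
have G01 : G 0 1 = k by [].
have GE00 : G 0 0 = a ^+ 2 by rewrite aa.
have GE11 : G 1 1 = (b ^+ 2 + k ^+ 2) / a ^+ 2.
  by rewrite bb aa -/h; field; rewrite gt_eqF.
move: (P) PE => {}P PE.
have l1 : lift ord0 ord0 = 1 :> 'I_2 by exact/val_inj.
have [an bn] : a != 0 /\ b != 0 by rewrite !gt_eqF.
have ij (m : 'I_2) : m = 0 \/ m = 1.
  by case: m => [[|[|//]]] ?; [left|right]; exact/val_inj.
apply/matrixP => i j; rewrite !mxE !big_ord_recl !big_ord0 !mxE !big_ord_recl !big_ord0.
rewrite l1 -[ord0]/(0 : 'I_2).
move: (a) (b) (k) an bn GC G01 GE00 GE11 PE => a' b' k' an bn GC G01 GE00 GE11 PE.
by case: (ij i) => ->; case: (ij j) => ->; rewrite ?PE ?GC ?G01 ?GE00 ?GE11 /=; field;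
  rewrite ?an ?bn.
Qed.
End Facts.

Section Smooth.
Context {R : realType} {V W : normedModType R}.

(* C^k on an open set U *)
Fixpoint Ck (k : nat) (U : set V) (f : V -> W) : Prop :=
  match k with
  | 0 => forall x, U x -> {for x, continuous f}
  | k'.+1 => (forall x, U x -> differentiable f x) /\
             (forall v, Ck k' U (fun x => 'D_v f x))
  end.

Definition smooth_on (U : set V) (f : V -> W) : Prop := forall k, Ck k U f.

End Smooth.

(* chinv need only be meaningful on the image of chdom under chmap. *)
Record chart (R : realType) (T : topologicalType) := Chart {
  chdom : set T;
  chmap : T -> 'rV[R]_2;
  chinv : 'rV[R]_2 -> T
}.

Definition is_chart (R : realType) (T : topologicalType) (c : chart R T) :=
  [/\ open (chdom c),
      open (chmap c @` chdom c),
      (forall p, chdom c p -> chinv c (chmap c p) = p),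
      {within chdom c, continuous (chmap c)} &
      {within chmap c @` chdom c, continuous (chinv c)}].

Record oriented_surface (R : realType) := OrientedSurface {
  surf :> topologicalType;
  surf_hausdorff : hausdorff_space surf;
  surf_countable : @second_countable surf;
  atlas : set (chart R surf);
  atlas_chart : forall c, atlas c -> is_chart c;
  atlas_cover : forall p, exists2 c, atlas c & chdom c p;
  atlas_smooth : forall c d, atlas c -> atlas d ->
    smooth_on (chmap c @` (chdom c `&` chdom d)) (chmap d \o chinv c);
  atlas_oriented : forall c d, atlas c -> atlas d ->
    forall x, (chmap c @` (chdom c `&` chdom d)) x ->
      0 < \det (jacobian (chmap d \o chinv c) x)
}.

Section Surface.
Context {R : realType} {N : oriented_surface R}.
Implicit Types (f : N -> 'rV[R]_4) (p : N) (c d : chart R N).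

(* The rows are the images under df_p of the coordinate vectors of c at p. *)
Definition coord_frame f c p : 'M[R]_(2, 4) :=
  jacobian (f \o chinv c) (chmap c p).

Definition immersion f : Prop :=
  forall c, atlas c ->
    smooth_on (chmap c @` chdom c) (f \o chinv c) /\
    (forall p, chdom c p -> \rank (coord_frame f c p) = 2%N).

(* The positive orthonormal bases of T_p N: orthonormal pairs that differ from
   an oriented coordinate frame by a matrix of positive determinant. *)
Definition tangent_onb f p : set 'M[R]_(2, 4) :=
  [set E | orthonormal_pair E /\
    exists c, [/\ atlas c, chdom c p &
      exists2 P : 'M[R]_2, 0 < \det P & E = P *m coord_frame f c p]].

(* T_p N as a 2-vector; independent of the chosen basis, see gaussE *)
Definition gauss f p : 'M[R]_4 := wedge_rows (get (tangent_onb f p)).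

Definition gauss_pm (s : bool) f p : 'M[R]_4 := proj_pm s (gauss f p).

Definition alpha_slant (J : {linear 'rV[R]_4 -> 'rV[R]_4}) (a : R) f : Prop :=
  forall p, alpha J (gauss f p) = a.

Definition slant (J : {linear 'rV[R]_4 -> 'rV[R]_4}) f : Prop :=
  exists2 a, 0 <= a <= pi & alpha_slant J a f.

Lemma chart_open_overlap c d : atlas c -> atlas d ->
  open (chmap c @` (chdom c `&` chdom d)).
Proof.
move=> /atlas_chart[oc oic cK _ cc] /atlas_chart[od _ _ _ _].
have -> : chmap c @` (chdom c `&` chdom d) =
    (chmap c @` chdom c) `&` (chinv c @^-1` chdom d).
  apply/seteqP; split => [_ [p [cp dp] <-]|_ [[p cp <-]]] /=.
    by split; [exists p|rewrite cK].
  by rewrite cK // => dp; exists p.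
by move: cc; rewrite continuous_open_subspace // => /(continuous_inP _ oic); exact.
Qed.

Lemma coord_frame_change f c d p : immersion f -> atlas c -> atlas d ->
  chdom c p -> chdom d p ->
  coord_frame f c p =
    jacobian (chmap d \o chinv c) (chmap c p) *m coord_frame f d p.
Proof.
move=> imf ac ad cp dp; set h := chmap d \o chinv c; set x := chmap c p.
have [_ _ cK _ _] := atlas_chart ac; have [_ _ dK _ _] := atlas_chart ad.
have hx : h x = chmap d p by rewrite /h /x /= cK.
have dh : differentiable h x.
  by have [+ _] := atlas_smooth ac ad 1%N; apply; exists p.
have dfc : differentiable (f \o chinv c) x.
  by have [/(_ 1%N)[+ _] _] := imf c ac; apply; exists p.
have dfd : differentiable (f \o chinv d) (h x).
  by have [/(_ 1%N)[+ _] _] := imf d ad; apply; rewrite hx; exists p.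
have dcomp : differentiable ((f \o chinv d) \o h) x by exact: differentiable_comp.
have eqn : \near x, (f \o chinv c) x = ((f \o chinv d) \o h) x.
  have : nbhs x (chmap c @` (chdom c `&` chdom d)).
    by apply: open_nbhs_nbhs; split; [exact: chart_open_overlap|exists p].
  by apply: filterS => _ [q [cq dq] <-] /=; rewrite /h /= cK // dK.
apply/row_matrixP => i; rewrite !rowE -!deriveEjacobian //.
rewrite (near_eq_derive _ eqn) deriveE // diff_comp //= /coord_frame -hx.
by rewrite mulmxA -!deriveEjacobian // !deriveE.
Qed.

Lemma gaussE f p E : immersion f -> tangent_onb f p E ->
  gauss f p = wedge_rows E.
Proof.
move=> imf TE.
have : tangent_onb f p (get (tangent_onb f p)) by apply: getPex; exists E.
rewrite /gauss; move: (get _) => F [oF [c [ac cp [P P0 FP]]]].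
have [oE [d [ad dp [Q Q0 EQ]]]] := TE.
have Qu : Q \in unitmx by rewrite unitmxE unitfE gt_eqF.
pose T := jacobian (chmap d \o chinv c) (chmap c p).
have T0 : 0 < \det T by apply: (atlas_oriented ac ad); exists p.
apply: (wedge_rows_eq (Q := P *m T *m invmx Q)) => //.
  by rewrite !det_mulmx det_inv !mulr_gt0 // invr_gt0.
have := coord_frame_change imf ac ad cp dp; rewrite -/T.
move: (coord_frame f c p) (coord_frame f d p) T {T0} FP EQ => Fc Fd T -> -> ->.
by rewrite (mulmxA _ Q) (mulmxKV Qu) mulmxA.
Qed.

Lemma gauss_G24 f p : immersion f -> G24 (gauss f p).
Proof.
move=> imf; have [c ac cp] := atlas_cover p.
have [_ /(_ p cp) /gram_schmidt [E oE PE]] := imf c ac.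
by exists E; split=> //; apply/esym/gaussE => //; split=> //; exists c.
Qed.

End Surface.

(* Main.v *)
(* For J in J^s the 2-vector zeta_J lies in /\^2_s E^4 and has norm sqrt 2, so
   cos (alpha_J V) = <V, zeta_J> = <pi_s V, zeta_J>, which on S^2_s (radius
   1 / sqrt 2) is the cosine of the angle with zeta_J: this is (2).  For (1), J
   is recovered from a circle by rescaling the normal n of its plane to norm
   sqrt 2: for A in /\^2_s E^4 one has A * star A = - Pf(A) I, hence
   A^2 = - (|A|^2 / 2) I, and A is then a complex structure.  Its orientation is
   read off from det B = Pf(zeta_J) for every J-basis B. *)
Require Import Defs.
From mathcomp Require Import all_boot all_order all_algebra.
From mathcomp Require Import all_classical all_reals all_analysis.
From mathcomp Require Import ring lra.
Import Order.TTheory GRing.Theory Num.Theory.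
Import numFieldNormedType.Exports.
Local Open Scope classical_set_scope.
Local Open Scope ring_scope.
Set Implicit Arguments.
Unset Strict Implicit.
Unset Printing Implicit Defensive.

Section TwoVectors.
Context {R : realType}.
Implicit Types (A B C V : 'M[R]_4) (X Y : 'rV[R]_4) (s : bool).
Implicit Types (J : {linear 'rV[R]_4 -> 'rV[R]_4}).

Local Notation o0 := (@Ordinal 4 0 isT).
Local Notation o1 := (@Ordinal 4 1 isT).
Local Notation o2 := (@Ordinal 4 2 isT).
Local Notation o3 := (@Ordinal 4 3 isT).

(** * Bilinear algebra of [dot] and [ip] *)

Lemma dotC X Y : dot X Y = dot Y X.
Proof. by rewrite !dotE; ring. Qed.

Lemma dotZl (a : R) X Y : dot (a *: X) Y = a * dot X Y.
Proof. by rewrite /dot -scalemxAl mxE. Qed.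

Lemma ipC A B : ip A B = ip B A.
Proof. by rewrite !ipE !sum4; ring. Qed.

Lemma ipDl A B C : ip (A + B) C = ip A C + ip B C.
Proof. by rewrite /ip mulmxDl linearD mulrDr. Qed.

Lemma ipZl (a : R) A B : ip (a *: A) B = a * ip A B.
Proof. by rewrite /ip -scalemxAl linearZ /= mulrCA. Qed.

Lemma ipDr A B C : ip A (B + C) = ip A B + ip A C.
Proof. by rewrite ipC ipDl !(ipC A). Qed.

Lemma ipZr (a : R) A B : ip A (a *: B) = a * ip A B.
Proof. by rewrite ipC ipZl ipC. Qed.

Lemma ipNl A B : ip (- A) B = - ip A B.
Proof. by rewrite -scaleN1r ipZl mulN1r. Qed.

Lemma ipNr A B : ip A (- B) = - ip A B.
Proof. by rewrite ipC ipNl ipC. Qed.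

Lemma ip_ge0 A : 0 <= ip A A.
Proof.
rewrite ipE mulr_ge0 ?invr_ge0 //; apply: sumr_ge0 => i _.
by apply: sumr_ge0 => j _; rewrite -expr2 sqr_ge0.
Qed.

Lemma ip_eq0 A : ip A A = 0 -> A = 0.
Proof.
rewrite ipE => /eqP; rewrite mulf_eq0 invr_eq0 pnatr_eq0 /=.
rewrite psumr_eq0 => [/allP A0|i _]; last first.
  by apply: sumr_ge0 => j _; rewrite -expr2 sqr_ge0.
apply/matrixP => i j; have := A0 i (mem_index_enum i).
rewrite /= psumr_eq0 => [/allP/(_ j (mem_index_enum j))|k _].
  by rewrite /= -expr2 sqrf_eq0 mxE => /eqP.
by rewrite -expr2 sqr_ge0.
Qed.

Lemma ip_gt0 A : A != 0 -> 0 < ip A A.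
Proof. by move=> A0; rewrite lt_def ip_ge0 andbT; apply: contra_neq A0 => /ip_eq0. Qed.

(** * Skew matrices, the star operator and the Pfaffian *)

Lemma skewE A : skew_mx A -> A = \matrix_(i < 4, j < 4)
  nth 0 (nth [::] [::
   [:: 0; A o0 o1; A o0 o2; A o0 o3];
   [:: - A o0 o1; 0; A o1 o2; A o1 o3];
   [:: - A o0 o2; - A o1 o2; 0; A o2 o3];
   [:: - A o0 o3; - A o1 o3; - A o2 o3; 0]] i) j.
Proof.
move=> sA; apply/matrixP; elim/forall4 => j; elim/forall4: j;
  rewrite mxE /= ?(skew0 sA) //; exact: skewP.
Qed.

(** The right-hand side is the coefficient of the 4-vector A /\ B on the standard volume element. *)
Lemma ip_starE A B : skew_mx A -> skew_mx B -> ip (star A) B =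
  A o0 o1 * B o2 o3 - A o0 o2 * B o1 o3 + A o0 o3 * B o1 o2 +
  A o1 o2 * B o0 o3 - A o1 o3 * B o0 o2 + A o2 o3 * B o0 o1.
Proof.
move=> sA sB; rewrite ipE !sum4 starE !mxE /=.
rewrite !(skew0 sB) (skewP sA o1 o0) (skewP sA o2 o0) (skewP sA o3 o0).
rewrite (skewP sA o2 o1) (skewP sA o3 o1) (skewP sA o3 o2).
rewrite (skewP sB o1 o0) (skewP sB o2 o0) (skewP sB o3 o0).
rewrite (skewP sB o2 o1) (skewP sB o3 o1) (skewP sB o3 o2).
by field.
Qed.

(* [2^-1 * ip (star A) A] is the Pfaffian of [A]. *)
Lemma mul_star A : skew_mx A ->
  A *m star A = - (2^-1 * ip (star A) A)%:M.
Proof.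
move=> sA; rewrite ip_starE // starE (skewE sA).
move: (A o0 o1) (A o0 o2) (A o0 o3) (A o1 o2) (A o1 o3) (A o2 o3) => a b c d e f.
apply/matrixP; elim/forall4 => j; elim/forall4: j;
  rewrite !mxE !sum4 !mxE /= ?mulr1n ?mulr0n.
all: by field.
Qed.

Lemma skew_wedge X Y : skew_mx (wedge X Y).
Proof. by apply/matrixP => i j; rewrite mxE [RHS]mxE !wedgeE; ring. Qed.

Lemma wedge_pmZ s (a : R) A : wedge_pm s A -> wedge_pm s (a *: A).
Proof.
move=> [sA eA]; split; last by rewrite starZ eA !scalerA mulrC.
by rewrite /skew_mx /= linearZ /= sA scalerN.
Qed.

(** Laplace expansion along the first two rows: both sides are the volume coefficient of the wedge
    of the four rows. *)
Lemma det_star B :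
  \det B = ip (star (wedge (row o0 B) (row o1 B))) (wedge (row o2 B) (row o3 B)).
Proof.
(* With entries indexed by [nat], the lifted ordinals of the cofactor expansion compute to numerals,
   which [ring] can match. *)
have [g ->] : exists g : nat -> nat -> R, B = \matrix_(i, j) g i j.
  exists (fun i j => B (inord i) (inord j)).
  by apply/matrixP => i j; rewrite mxE !inord_val.
rewrite ip_starE; [|exact: skew_wedge..].
rewrite !wedgeE !mxE /= (expand_det_row _ ord0) sum4 /cofactor.
rewrite !(expand_det_row _ (ord0 : 'I_3)) !big_ord_recl !big_ord0 /cofactor.
rewrite !det2 !mxE /= /bump /=.
by rewrite !(expr0, exprS); ring.
Qed.

Lemma ip_star_wedge X Y : ip (star (wedge X Y)) (wedge X Y) = 0.
Proof. by rewrite ip_starE ?wedgeE; [ring|exact: skew_wedge..]. Qed.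

(** * Complex structures and the 2-vectors [zeta J] *)

Lemma dot_J J X Y : cstruct J -> dot (J X) Y = - dot X (J Y).
Proof.
move=> [J2 Jo].
by rewrite -(Jo X) J2 /dot; rewrite (raddfN (@trmx R 1 4)) mulmxN !mxE opprK.
Qed.

(** [J] is skew-adjoint, so its matrix for row vectors is skew and the sign and transpose in [zeta]
    cancel. *)
Lemma cstruct_mx J : cstruct J ->
  [/\ skew_mx (zeta J), forall X, J X = X *m zeta J & zeta J *m zeta J = - 1%:M].
Proof.
move=> cJ; have [J2 _] := cJ.
have JM (U : 'rV[R]_4) : J U = U *m lin1_mx J by rewrite mul_rV_lin1.
have zE : zeta J = - (lin1_mx J)^T.
  by apply/matrixP => i j; rewrite !mxE JM -rowE /dot -rowE !mxE.
have sM : skew_mx (lin1_mx J).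
  apply/matrixP => i j; have := dot_J (delta_mx 0 i) (delta_mx 0 j) cJ.
  by rewrite !JM -!rowE /dot trmx_delta -colE -rowE !mxE => ->; rewrite opprK.
have zM : zeta J = lin1_mx J by rewrite zE sM opprK.
rewrite zM; split=> //.
by apply/row_matrixP => i; rewrite !rowE mulmxA -!JM J2 mulmxN mulmx1.
Qed.

Lemma ip_zeta J : cstruct J -> ip (zeta J) (zeta J) = 2.
Proof.
move=> /cstruct_mx[sz _ zz]; rewrite /ip sz mulmxN zz opprK mxtrace1.
by field.
Qed.

(** Multiply [mul_star] on the left by [zeta J], whose square is -I: [zeta J] is an eigenvector of
    [star], with its Pfaffian as eigenvalue. *)
Lemma star_zeta J : cstruct J ->
  star (zeta J) = (2^-1 * ip (star (zeta J)) (zeta J)) *: zeta J.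
Proof.
move=> /cstruct_mx[sz _ zz]; rewrite -[LHS]opprK -[in LHS](mul1mx (star _)) -mulNmx -zz.
by rewrite -mulmxA mul_star // mulmxN opprK mul_mx_scalar.
Qed.

(** In a J-basis [zeta J] is e1 /\ e2 + e3 /\ e4. The decomposable terms pair to 0 with their own
    stars, and each of the two cross terms is [\det B]. *)
Lemma det_J_basis J B : cstruct J -> J_basis J B ->
  \det B = 2^-1 * ip (star (zeta J)) (zeta J).
Proof.
move=> cJ [oB J0 J2]; have [sz JE zz] := cstruct_mx cJ.
move: J0 J2; rewrite !JE.
rewrite (_ : inord 0 = o0); last exact/val_inj/inordK.
rewrite (_ : inord 1 = o1); last exact/val_inj/inordK.
rewrite (_ : inord 2 = o2); last exact/val_inj/inordK.
rewrite (_ : inord 3 = o3); last exact/val_inj/inordK.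
move=> J0 J2.
have J1 : row o1 B *m zeta J = - row o0 B by rewrite -J0 -mulmxA zz mulmxN mulmx1.
have J3 : row o3 B *m zeta J = - row o2 B by rewrite -J2 -mulmxA zz mulmxN mulmx1.
have zE : zeta J = wedge (row o0 B) (row o1 B) + wedge (row o2 B) (row o3 B).
  (* Inserting B^T B = I writes [zeta J] as the sum of the e_k^T (J e_k). *)
  rewrite -[LHS]mul1mx -(mulmx1C oB) -mulmxA.
  apply/matrixP => i j; rewrite mxE sum4 [RHS]mxE !wedgeE.
  have e (k : 'I_4) : (B *m zeta J) k j = (row k B *m zeta J) 0 j.
    by rewrite -row_mul [RHS]mxE.
  by rewrite !e J0 J1 J2 J3 !mxE; ring.
rewrite zE starD ipDl !(ipDr _ (wedge _ _) (wedge _ _)) !ip_star_wedge -det_star.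
rewrite [ip (star (wedge (row o2 B) _)) _]ip_star ipC -det_star.
by field.
Qed.

(** Two linear conditions on a 4-space have a nonzero common solution, which is then normalized. *)
Lemma exists_unit_orth X Y :
  exists Z : 'rV[R]_4, [/\ dot Z Z = 1, dot Z X = 0 & dot Z Y = 0].
Proof.
pose K := kermx (row_mx X^T Y^T).
have K0 : K != 0.
  rewrite -mxrank_eq0 mxrank_ker subn_eq0 -ltnNge.
  exact: leq_ltn_trans (rank_leq_col _) _.
have := sub_kermxP (nz_row_sub K).
rewrite mul_mx_row -[RHS]row_mx0 => /eq_row_mx[KX KY].
have k0 : 0 < dot (nz_row K) (nz_row K).
  rewrite lt_def dot_ge0 andbT; apply: contra_neq K0 => /dot_eq0 K0.
  by apply/eqP; rewrite -nz_row_eq0; apply/eqP.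
set k := dot _ _ in k0.
exists ((Num.sqrt k)^-1 *: nz_row K); split.
- rewrite dotZl dotC dotZl -/k mulrA -expr2 exprVn.
  by rewrite sqr_sqrtr ?ltW // mulVf ?gt_eqF.
- by rewrite dotZl /dot KX mxE mulr0.
- by rewrite dotZl /dot KY mxE mulr0.
Qed.

Lemma dot_J_self J X : cstruct J -> dot X (J X) = 0.
Proof. by move=> cJ; have := dot_J X X cJ; rewrite dotC; lra. Qed.

(** Guarantees that the quantifier over J-bases in [cstruct_pm] is not vacuous. The basis is X, JX,
    Y, JY with Y a unit vector orthogonal to X and JX. *)
Lemma J_basis_exists J : cstruct J -> exists B, J_basis J B.
Proof.
move=> cJ; have [J2 Jo] := cJ.
pose X : 'rV[R]_4 := delta_mx 0 0.
have X1 : dot X X = 1 by rewrite dotE !mxE /=; ring.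
have [Y [Y1 YX YJ]] := exists_unit_orth X (J X).
pose r (i : nat) := nth 0 [:: X; J X; Y; J Y] i.
have rowr (i : 'I_4) : row i (\matrix_i r i) = r i by rewrite rowK.
exists (\matrix_i r i); split; last 2 first.
- by rewrite !rowr !inordK.
- by rewrite !rowr !inordK.
apply/matrixP => i j.
have -> : ((\matrix_i r i) *m (\matrix_i r i)^T) i j = dot (r i) (r j).
  by rewrite /dot !mxE; apply: eq_bigr => k _; rewrite !mxE.
have XJY : dot X (J Y) = 0 by rewrite -[LHS]opprK -dot_J // dotC YJ oppr0.
have JXX := dot_J_self X cJ; have JYY := dot_J_self Y cJ.
have JYX : dot (J Y) (J X) = 0 by rewrite Jo.
move: i j; elim/forall4; elim/forall4; rewrite !mxE /= /r /= ?mulr1n ?mulr0n ?Jo //.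
all: by rewrite dotC // ?Jo.
Qed.

(** The determinant of any J-basis is the eigenvalue of [star] at [zeta J], so its sign decides
    which eigenspace contains [zeta J]. *)
Lemma cstruct_pmP s J : cstruct J -> cstruct_pm s J <-> wedge_pm s (zeta J).
Proof.
move=> cJ; have [sz _ _] := cstruct_mx cJ; split=> [[_ Js]|[_ es]].
  split=> //; have [B JB] := J_basis_exists cJ; have dB_gt0 := Js _ JB.
  have dB : \det B ^+ 2 = 1.
    by case: JB => oB _ _; rewrite expr2 -{2}det_tr -det_mulmx oB det1.
  have dBs : \det B = (-1) ^+ s.
    move/eqP: dB dB_gt0; rewrite sqrf_eq1 => /orP[]/eqP->; case: s {Js} => /=;
      rewrite ?expr0 ?expr1 //; lra.
  by rewrite star_zeta // -(det_J_basis cJ JB) dBs.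
split=> // B /(det_J_basis cJ) ->.
by rewrite es ipZl ip_zeta // mulrCA (mulrA ((-1) ^+ s)) -expr2 sqrr_sign; lra.
Qed.

Lemma cstruct_of_wedge_pm s A : wedge_pm s A -> ip A A = 2 ->
  exists2 J, cstruct_pm s J & zeta J = A.
Proof.
move=> wA A2; have [sA eA] := wA.
have AA : A *m A = - 1%:M.
  have := mul_star sA; rewrite eA -scalemxAr ipZl A2 => /(congr1 ( *:%R ((-1) ^+ s))).
  rewrite scalerA -expr2 sqrr_sign scale1r => ->.
  rewrite scalerN scale_scalar_mx mulrCA (mulrA ((-1) ^+ s)) -expr2 sqrr_sign.
  by rewrite mul1r mulVf // pnatr_eq0.
pose J : {linear 'rV[R]_4 -> 'rV[R]_4} := mulmxr A.
have cJ : cstruct J.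
  split=> [X|X Y]; rewrite /J /=.
    by rewrite -mulmxA AA mulmxN mulmx1.
  by rewrite /dot trmx_mul mulmxA -(mulmxA X) sA mulmxN AA opprK mulmx1.
have zA : zeta J = A.
  apply/matrixP => i j.
  by rewrite mxE /J /= dotC /dot trmx_delta -colE -rowE !mxE [RHS](skewP sA).
by exists J => //; apply/(cstruct_pmP _ cJ); rewrite zA.
Qed.

(** * The spheres [S2] and the projections of oriented planes *)

Lemma S2P s A : S2 s A <-> wedge_pm s A /\ ip A A = 2^-1.
Proof.
rewrite /S2 /norm2 /= -sqrtrV ?ler0n //; split=> -[wA e]; split=> //; last by rewrite e.
by rewrite -[LHS]sqr_sqrtr ?ip_ge0 // e sqr_sqrtr // invr_ge0.
Qed.

Lemma ip_proj s A B : skew_mx A -> wedge_pm s B -> ip (proj_pm s A) B = ip A B.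
Proof.
move=> sA /(proj_orth sA)/eqP.
by rewrite ipDl ipNl subr_eq0 => /eqP ->.
Qed.

(** For V = X /\ Y, the squared norm of the projection is <V, proj V> = (|V|^2 + (-1)^s <V, star V>)
    / 2, and <V, star V> = 0. *)
Lemma S2_proj_wedge s X Y : dot X X = 1 -> dot Y Y = 1 -> dot X Y = 0 ->
  S2 s (proj_pm s (wedge X Y)).
Proof.
move=> X1 Y1 XY; have sw := skew_wedge X Y; apply/S2P; split; first exact: proj_in.
rewrite ip_proj //; last exact: proj_in.
rewrite /proj_pm ipZr ipDr ipZr [ip _ (star _)]ipC ip_star_wedge mulr0 addr0.
by rewrite ip_wedge X1 Y1 XY mul0r subr0 !mulr1.
Qed.

Lemma G24P V : G24 V -> exists X Y,
  [/\ dot X X = 1, dot Y Y = 1, dot X Y = 0 & V = wedge X Y].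
Proof.
move=> [E [/matrixP oE <-]]; exists (row 0 E), (row 1 E).
have d i j : dot (row i E) (row j E) = (i == j)%:R.
  have := oE i j; rewrite [RHS]mxE => <-; rewrite /dot !mxE.
  by apply: eq_bigr => k _; rewrite !mxE.
by rewrite !d.
Qed.

Lemma G24_skew V : G24 V -> skew_mx V.
Proof. by move=> /G24P[X [Y [_ _ _ ->]]]; exact: skew_wedge. Qed.

Lemma S2_proj s V : G24 V -> S2 s (proj_pm s V).
Proof. by move=> /G24P[X [Y [? ? ? ->]]]; exact: S2_proj_wedge. Qed.

Lemma wedge_pm_zeta s J : cstruct_pm s J -> wedge_pm s (zeta J).
Proof. by move=> cJ; apply/cstruct_pmP => //; case: cJ. Qed.

Lemma alpha_zeta s J V : cstruct_pm s J -> G24 V ->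
  alpha J V = acos (ip (proj_pm s V) (zeta J)).
Proof.
move=> sJ GV; have cJ : cstruct J by case: sJ.
rewrite ip_proj; [|exact: G24_skew|exact: wedge_pm_zeta].
case: GV => E VE; rewrite (alphaE cJ VE); case: VE => _ <-.
by rewrite ipC zeta_wedge // dot_J.
Qed.

(** Cauchy-Schwarz for [zeta J] and [2 *: A], both of norm sqrt 2; it places the pairing in the
    interval where [cos] inverts [acos]. *)
Lemma ip_zeta_itv s J A : cstruct_pm s J -> S2 s A -> -1 <= ip A (zeta J) <= 1.
Proof.
move=> [cJ _] /S2P[_ AA].
have := ip_ge0 (zeta J + 2 *: A); have := ip_ge0 (zeta J - 2 *: A).
rewrite !(ipDl, ipDr, ipNl, ipNr, ipZl, ipZr) ip_zeta // AA [ip (zeta J) A]ipC.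
lra.
Qed.

Lemma angle_zeta s J A : cstruct_pm s J -> S2 s A ->
  angle A (zeta J) = acos (ip A (zeta J)).
Proof.
move=> [cJ _] [_ nA]; rewrite /angle nA /norm2 ip_zeta //.
by rewrite mulVf ?divr1 // sqrtr_eq0 -ltNge ltr0n.
Qed.

(** * Circles on [S2] and slices at constant pairing with [zeta J] *)

Lemma S2_slice_circle s J (k : R) : cstruct_pm s J -> -1 <= k <= 1 ->
  exists2 C, circle_on_S2 s C & forall A, S2 s A -> ip A (zeta J) = k -> C A.
Proof.
move=> sJ k1; have [cJ _] := sJ; have wz := wedge_pm_zeta sJ; have zz := ip_zeta cJ.
have [kk|kk] := ltP (k ^+ 2) 1.
(* The center is the multiple of [zeta J] whose pairing with [zeta J] is [k]. By Pythagoras r^2 =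
   1/2 - |c|^2 with |c|^2 = k^2 / 2. *)
- pose c := (2^-1 * k) *: zeta J; pose r := Num.sqrt (2^-1 * (1 - k ^+ 2)).
  have r0 : 0 < r by rewrite sqrtr_gt0; lra.
  exists [set A | [/\ wedge_pm s A, ip (A - c) (zeta J) = 0 & norm2 (A - c) = r]].
    split=> [A [wA An Ar]|]; last first.
      exists c, (zeta J), r; split=> //; first exact: wedge_pmZ.
      by apply/eqP => z0; move: zz; rewrite z0 -(scale0r 0) ipZl mul0r; lra.
    apply/S2P; split=> //.
    have : ip (A - c) (A - c) = r ^+ 2 by rewrite -Ar sqr_sqrtr ?ip_ge0.
    rewrite sqr_sqrtr; last by lra.
    move: An; rewrite /c !(ipDl, ipDr, ipNl, ipNr, ipZl, ipZr) zz.
    rewrite [ip (zeta J) A]ipC => An.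
    have -> : ip A (zeta J) = k by lra.
    lra.
  move=> A /S2P[wA AA] Ak; split=> //.
    by rewrite ipDl ipNl ipZl zz Ak; field.
  congr Num.sqrt; rewrite /c !(ipDl, ipDr, ipNl, ipNr, ipZl, ipZr) zz.
  rewrite [ip (zeta J) A]ipC Ak AA.
  by field.
(* The slice is the single point [k / 2 *: zeta J]; a great circle through it
   is cut out by any [n] orthogonal to [zeta J]. *)
have k2 : k ^+ 2 = 1 by apply/eqP; rewrite eq_le kk andbT; nra.
pose X : 'rV[R]_4 := delta_mx 0 0.
have X1 : dot X X = 1 by rewrite dotE !mxE /=; ring.
have [Y [Y1 YX YJ]] := exists_unit_orth X (J X).
(* Since Y is orthogonal to JX, X /\ Y pairs to 0 with [zeta J], and so does its projection, which
   is nonzero because it lies on [S2]. *)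
pose n := proj_pm s (wedge X Y).
have /S2P[wn nn] : S2 s n by apply: S2_proj_wedge => //; rewrite dotC.
have nz : ip n (zeta J) = 0.
  rewrite ip_proj //; last exact: skew_wedge.
  by rewrite ipC zeta_wedge // -dot_J // dotC.
exists [set A | [/\ wedge_pm s A, ip (A - 0) n = 0 & norm2 (A - 0) = (Num.sqrt 2)^-1]].
  split=> [A [wA _]|]; first by rewrite subr0.
  exists 0, n, (Num.sqrt 2)^-1; split=> //.
  - by rewrite -(scale0r n); exact: wedge_pmZ.
  - by apply/eqP => n0; move: nn; rewrite n0 -(scale0r 0) ipZl mul0r; lra.
move=> A SA Ak; have [wA nA] := SA; have /S2P[_ AA] := SA.
split; rewrite ?subr0 //.
(* The squared distance is 1/2 - k^2 / 2, which vanishes here. *)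
have /ip_eq0/eqP : ip (A - (2^-1 * k) *: zeta J) (A - (2^-1 * k) *: zeta J) = 0.
  rewrite !(ipDl, ipDr, ipNl, ipNr, ipZl, ipZr) zz [ip (zeta J) A]ipC Ak AA; lra.
by rewrite subr_eq0 => /eqP ->; rewrite ipZl ipC nz mulr0.
Qed.

Lemma circle_slice s (C : set 'M[R]_4) : circle_on_S2 s C ->
  exists2 J, cstruct_pm s J & exists k, forall A, C A -> ip A (zeta J) = k.
Proof.
move=> [_ [c [n [r [_ wn n0 _ ->]]]]].
have nn := ip_gt0 n0; pose l := Num.sqrt (2 / ip n n).
have [||J sJ zJ] := @cstruct_of_wedge_pm s (l *: n).
- exact: wedge_pmZ.
- rewrite ipZl ipZr mulrA -expr2 sqr_sqrtr ?divfK ?gt_eqF //.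
  by rewrite divr_ge0 ?ltW.
(* On the plane through [c] normal to [n], the pairing with [l *: n] keeps its value at [c]. *)
exists J => //; exists (l * ip c n) => A [_ An _].
by move: An; rewrite zJ ipZr ipDl ipNl => /eqP; rewrite subr_eq0 => /eqP ->.
Qed.

End TwoVectors.

Theorem proposition3p1 (R : realType) (N : oriented_surface R)
    (f : N -> 'rV[R]_4) (hf : immersion f) :
  (forall s : bool,
     (exists2 J, cstruct_pm s J & slant J f) <->
     (exists2 C, circle_on_S2 s C & range (gauss_pm s f) `<=` C)) /\
  (forall (s : bool) (J : {linear 'rV[R]_4 -> 'rV[R]_4}) (a : R),
     cstruct_pm s J -> 0 <= a <= pi ->
     (alpha_slant J a f <-> range (gauss_pm s f) `<=` S_circle s J a)).
Proof.
have gG p := gauss_G24 p hf.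
have gS2 s p : S2 s (gauss_pm s f p) by apply: S2_proj.
(* Part (2) first: the slant angle at [p] and the angle of [gauss_pm s f p] with [zeta J] are [acos]
   of the same number. *)
split=> [s|s J a sJ _]; last first.
  split=> [af _ [p _ <-]|af p].
    by split; rewrite ?(angle_zeta sJ) // -(af p) (alpha_zeta sJ).
  have [_ <-] := af _ (ex_intro2 _ _ p I erefl).
  by rewrite (alpha_zeta sJ) // (angle_zeta sJ).
split=> [[J sJ [a _ af]]|[C cC fC]].
  have key p : ip (gauss_pm s f p) (zeta J) = cos a.
    rewrite -(af p) (alpha_zeta sJ) // acosK // in_itv /=.
    exact: (ip_zeta_itv sJ (gS2 s p)).
  have ca : -1 <= cos a <= 1 by rewrite cos_geN1 cos_le1.
  have [C cC CS] := S2_slice_circle sJ ca.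
  by exists C => // _ [p _ <-]; exact: CS.
have [J sJ [k Ck]] := circle_slice cC; exists J => //.
have key p : ip (gauss_pm s f p) (zeta J) = k by apply: Ck; apply: fC; exists p.
(* A point of [N] is what bounds [k] by 1 in absolute value, making [acos k] the slant angle; on an
   empty [N] any angle, such as 0, works. *)
have [[p]|N0] := pselect (inhabited N).
  have kI : -1 <= k <= 1 by rewrite -(key p); exact: (ip_zeta_itv sJ).
  exists (acos k); first by rewrite acos_ge0 ?acos_lepi /=.
  by move=> q; rewrite (alpha_zeta sJ) // key.
by exists 0; [rewrite lexx pi_ge0|move=> q; case: N0].
Qed.
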